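(* Let $F$ be a contracting normal velocity that is homogeneous of degree $\sigma\in(0,1)$. Then there exists no maximum-principle function (MPF) for $F$.
   Context: Notation: $\mathbb{R}^2_+=(0,\infty)^2$; subscripts $a,b$ denote partial derivatives. Normal velocity: a symmetric function $F\in C^2(\mathbb{R}^2_+)$, homogeneous of some degree $\sigma\in\mathbb{R}\setminus\{0\}$, with $F_a,F_b>0$ for all $a,b>0$. It is contracting if $F>0$ everywhere on $\mathbb{R}^2_+$ and expanding if $F<0$ everywhere on $\mathbb{R}^2_+$. Maximum-principle function (MPF) for a normal velocity $F$: a symmetric function $w\in C^2(\mathbb{R}^2_+)$, homogeneous of some degree $\chi\in\mathbb{R}\setminus\{0\}$, such that, with $\alpha=-w_a/w_b$ and $\alpha_a=\partial\alpha/\partial a$ (defined for $a\ne b$): (1) $w>0$ whenever $a\neq b$, and $w=0$ whenever $a=b$. (2) $\chi>0$ if $F$ is contracting, $\chi<0$ if $F$ is expanding. (3) $w_a<0$ for all $0<a<b$, and $w_a>0$ for all $0<b<a$. (4) For all $a,b>0$ (for $E_w,G_w$: $a\neq b$) one has $C_w(a,b)\le0$, $E_w(a,b)\le0$, $G_w(a,b)\le 0$, where $$C_w=w_a\,a\big((F_aa^2+F_bb^2)+(F-F_aa-F_bb)a\big)+w_b\,b\big((F_aa^2+F_bb^2)+(F-F_aa-F_bb)b\big),$$ $$E_w=w_a(F_{aa}+2F_{ab}\alpha+F_{bb}\alpha^2)-F_a(w_{aa}+2w_{ab}\alpha+w_{bb}\alpha^2)+2\,\frac{w_bF_a-w_aF_b}{a-b}\,\alpha^2,$$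 $$G_w=\frac1{\alpha^2}\Big(w_b(F_{aa}+2F_{ab}\alpha+F_{bb}\alpha^2)-F_b(w_{aa}+2w_{ab}\alpha+w_{bb}\alpha^2)+2\,\frac{w_bF_a-w_aF_b}{a-b}\Big).$$ (5) There are constants $c>0$, $d\in\mathbb{R}$ such that, evaluating $\alpha$ and $\alpha_a$ at $(a,b)=(\rho,1)$ with $0<\rho<1$: if $F$ is contracting, then either $\alpha=c$ and $\alpha_a=0$ for all sufficiently small $\rho$, or, as $\rho\to0$, $\alpha=\frac c\rho+o(\rho^{-1})$ and $\alpha_a=-\frac c{\rho^2}+o(\rho^{-1})$; if $F$ is expanding, then, as $\rho\to0$, either $\alpha=\frac c\rho+o(\rho^{-1})$ and $\alpha_a=-\frac c{\rho^2}+o(\rho^{-1})$, or $\alpha=\frac{c+d\rho}{\rho^2}+o(\rho^{-1})$ and $\alpha_a=-\frac{2c+d\rho}{\rho^3}+o(\rho^{-1})$. *)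

(* Defs.v *)
From Stdlib Require Import Reals.
From Coquelicot Require Import Coquelicot.

Open Scope R_scope.

(* Functions on the open quadrant (0,+oo)^2 are represented by total functions
   R -> R -> R; every condition below only involves their values, hence their
   derivatives, at points with both coordinates positive. *)

Definition d_a (f : R -> R -> R) : R -> R -> R := partial_derive 1 0 f.
Definition d_b (f : R -> R -> R) : R -> R -> R := partial_derive 0 1 f.
Definition d_aa (f : R -> R -> R) : R -> R -> R := partial_derive 2 0 f.
Definition d_ab (f : R -> R -> R) : R -> R -> R := partial_derive 1 1 f.
Definition d_bb (f : R -> R -> R) : R -> R -> R := partial_derive 0 2 f.

(* [ex_diff_n f 2 a b] is pointwise; required at all points of the open
   quadrant it says that all partial derivatives of order at most 2 exist and
   are continuous there as functions of two variables. *)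
Definition C2_on_quadrant (f : R -> R -> R) : Prop :=
  forall a b : R, 0 < a -> 0 < b -> ex_diff_n f 2 a b.

Definition symmetric_on_quadrant (f : R -> R -> R) : Prop :=
  forall a b : R, 0 < a -> 0 < b -> f a b = f b a.

Definition homogeneous (s : R) (f : R -> R -> R) : Prop :=
  forall t a b : R, 0 < t -> 0 < a -> 0 < b ->
    f (t * a) (t * b) = Rpower t s * f a b.

Record normal_velocity (F : R -> R -> R) : Prop := {
  nv_sym : symmetric_on_quadrant F;
  nv_C2 : C2_on_quadrant F;
  nv_hom : exists sigma : R, sigma <> 0 /\ homogeneous sigma F;
  nv_incr : forall a b : R, 0 < a -> 0 < b -> 0 < d_a F a b /\ 0 < d_b F a b
}.

Definition contracting (F : R -> R -> R) : Prop :=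
  forall a b : R, 0 < a -> 0 < b -> 0 < F a b.

Definition expanding (F : R -> R -> R) : Prop :=
  forall a b : R, 0 < a -> 0 < b -> F a b < 0.

Definition alpha (w : R -> R -> R) (a b : R) : R := - d_a w a b / d_b w a b.

Definition hess_alpha (w f : R -> R -> R) (a b : R) : R :=
  d_aa f a b + 2 * d_ab f a b * alpha w a b + d_bb f a b * alpha w a b ^ 2.

Definition C_term (F w : R -> R -> R) (a b : R) : R :=
  let Fa := d_a F a b in
  let Fb := d_b F a b in
  d_a w a b * a *
    ((Fa * a ^ 2 + Fb * b ^ 2) + (F a b - Fa * a - Fb * b) * a) +
  d_b w a b * b *
    ((Fa * a ^ 2 + Fb * b ^ 2) + (F a b - Fa * a - Fb * b) * b).

Definition E_term (F w : R -> R -> R) (a b : R) : R :=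
  d_a w a b * hess_alpha w F a b - d_a F a b * hess_alpha w w a b +
  2 * ((d_b w a b * d_a F a b - d_a w a b * d_b F a b) / (a - b)) *
    alpha w a b ^ 2.

Definition G_term (F w : R -> R -> R) (a b : R) : R :=
  1 / alpha w a b ^ 2 *
  (d_b w a b * hess_alpha w F a b - d_b F a b * hess_alpha w w a b +
   2 * ((d_b w a b * d_a F a b - d_a w a b * d_b F a b) / (a - b))).

(* f(rho) = g(rho) + o(1/rho) as rho -> 0, rho > 0. *)
Definition eq_o_inv (f g : R -> R) : Prop :=
  is_domin (at_right 0) (fun rho : R => / rho : R_NormedModule)
    (fun rho : R => f rho - g rho : R_NormedModule).

Definition asymp_const (w : R -> R -> R) (c : R) : Prop :=
  at_right 0 (fun rho : R => alpha w rho 1 = c /\ d_a (alpha w) rho 1 = 0).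

Definition asymp_first (w : R -> R -> R) (c : R) : Prop :=
  eq_o_inv (fun rho => alpha w rho 1) (fun rho => c / rho) /\
  eq_o_inv (fun rho => d_a (alpha w) rho 1) (fun rho => - (c / rho ^ 2)).

Definition asymp_second (w : R -> R -> R) (c d : R) : Prop :=
  eq_o_inv (fun rho => alpha w rho 1) (fun rho => (c + d * rho) / rho ^ 2) /\
  eq_o_inv (fun rho => d_a (alpha w) rho 1)
    (fun rho => - ((2 * c + d * rho) / rho ^ 3)).

(* MPF: maximum-principle function. *)
Record MPF (F w : R -> R -> R) : Prop := {
  mpf_sym : symmetric_on_quadrant w;
  mpf_C2 : C2_on_quadrant w;
  mpf_pos : forall a b : R, 0 < a -> 0 < b -> a <> b -> 0 < w a b;
  mpf_diag : forall a : R, 0 < a -> w a a = 0;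
  mpf_hom : exists chi : R, chi <> 0 /\ homogeneous chi w /\
    (contracting F -> 0 < chi) /\ (expanding F -> chi < 0);
  mpf_decr : forall a b : R, 0 < a -> a < b -> d_a w a b < 0;
  mpf_incr : forall a b : R, 0 < b -> b < a -> 0 < d_a w a b;
  mpf_C : forall a b : R, 0 < a -> 0 < b -> C_term F w a b <= 0;
  mpf_E : forall a b : R, 0 < a -> 0 < b -> a <> b -> E_term F w a b <= 0;
  mpf_G : forall a b : R, 0 < a -> 0 < b -> a <> b -> G_term F w a b <= 0;
  mpf_asymp : exists c d : R, 0 < c /\
    (contracting F -> asymp_const w c \/ asymp_first w c) /\
    (expanding F -> asymp_first w c \/ asymp_second w c d)
}.

(* Main.v *)
(* On [a < b] the conditions [w_a < 0 < w_b], [chi > 0] and [w > 0] already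
   contradict [C_w <= 0]: Euler's relations [a w_a + b w_b = chi w] and
   [a F_a + b F_b = sigma F] turn [C_w] into
   [chi w (F_a a^2 + F_b b^2 + (1 - sigma) F a) + (1 - sigma) F w_b b (b - a)],
   every term of which is positive when [0 < sigma < 1]. *)
Require Import Defs.
From Stdlib Require Import Reals Lra.
From Coquelicot Require Import Coquelicot.

(** Total differentiability comes from [d_a f] existing on a neighbourhood (the quadrant is open)
    and being continuous at [(a, b)], together with the existence of [d_b f] at that point. *)
Lemma C2_differentiable (f : R -> R -> R) (a b : R) :
  C2_on_quadrant f -> 0 < a -> 0 < b ->
  differentiable_pt_lim f a b (d_a f a b) (d_b f a b).
Proof.
  intros Hf Ha Hb.
  destruct (Hf a b Ha Hb) as (_ & _ & Hfb & (Hcont & _) & _).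
  apply filterdiff_differentiable_pt_lim.
  apply (is_derive_filterdiff f a b (d_a f) (d_b f a b)).
  - apply filter_imp with (fun u => 0 < fst u /\ 0 < snd u).
    2: { apply filter_and.
         - exact (continuous_fst a b _ (open_gt 0 a Ha)).
         - exact (continuous_snd a b _ (open_gt 0 b Hb)). }
    intros [u v] [Hu Hv].
    destruct (Hf u v Hu Hv) as (_ & Hfa & _).
    exact (Derive_correct _ _ Hfa).
  - exact (Derive_correct _ _ Hfb).
  - apply filterlim_locally; intros eps.
    exact (proj1 (locally_2d_locally _ a b) (Hcont eps)).
Qed.

(** Differentiate [f (t * a) (t * b)] at [t = 1] twice: by the chain rule, and as
    [Rpower t s * f a b]. *)
Lemma Euler_homogeneous (f : R -> R -> R) (s a b : R) :
  C2_on_quadrant f -> homogeneous s f -> 0 < a -> 0 < b ->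
  a * d_a f a b + b * d_b f a b = s * f a b.
Proof.
  intros Hf Hs Ha Hb.
  assert (Hlin : forall x, is_derive (fun t => t * x) 1 x).
  { intros x; auto_derive; [easy | ring]. }
  assert (Hray : is_derive (fun t => f (t * a) (t * b)) 1
                   (d_a f a b * a + d_b f a b * b)).
  { apply is_derive_Reals, derivable_pt_lim_comp_2d; try apply is_derive_Reals, Hlin.
    rewrite !Rmult_1_l; now apply C2_differentiable. }
  assert (Hpow : is_derive (fun t => f (t * a) (t * b)) 1 (s * f a b)).
  (* Homogeneity is available for [0 < t] only, so the two functions are compared near [1]. *)
  { apply is_derive_ext_loc with (fun t => f a b * Rpower t s).
    - apply filter_imp with (2 := open_gt 0 1 Rlt_0_1); intros t Ht.
      rewrite Hs by assumption; apply Rmult_comm.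
    - replace (s * f a b) with (f a b * (s * Rpower 1 (s - 1))).
      + apply is_derive_scal, is_derive_Reals, derivable_pt_lim_power, Rlt_0_1.
      + unfold Rpower; rewrite ln_1, Rmult_0_r, exp_0; ring. }
  apply is_derive_unique in Hray; apply is_derive_unique in Hpow; lra.
Qed.

Lemma d_b_symmetric (f : R -> R -> R) (a b : R) :
  symmetric_on_quadrant f -> 0 < a -> 0 < b -> d_b f a b = d_a f b a.
Proof.
  intros Hf Ha Hb.
  apply Derive_ext_loc.
  apply filter_imp with (2 := open_gt 0 b Hb); intros t Ht.
  now apply Hf.
Qed.

Theorem lemma5p6 (F : R -> R -> R) (sigma : R) :
  normal_velocity F ->
  contracting F ->
  0 < sigma < 1 ->
  homogeneous sigma F ->
  ~ (exists w : R -> R -> R, MPF F w).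
Proof.
  intros HF Fpos Hsigma Fhom [w Hw].
  destruct (mpf_hom _ _ Hw) as (chi & _ & whom & Hchi & _).
  specialize (Hchi Fpos).
  (* A single point with [a < b] gives the contradiction; [(1, 2)] is chosen. *)
  pose proof (Euler_homogeneous F sigma 1 2 (nv_C2 _ HF) Fhom ltac:(lra) ltac:(lra)) as EF.
  pose proof (Euler_homogeneous w chi 1 2 (mpf_C2 _ _ Hw) whom ltac:(lra) ltac:(lra)) as Ew.
  pose proof (nv_incr _ HF 1 2 ltac:(lra) ltac:(lra)) as [Fa Fb].
  (* The sign of [d_b w] at [(1, 2)] is that of [d_a w] at the reflected point [(2, 1)]. *)
  pose proof (mpf_incr _ _ Hw 2 1 ltac:(lra) ltac:(lra)) as wb.
  rewrite <- (d_b_symmetric w 1 2 (mpf_sym _ _ Hw)) in wb by lra.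
  pose proof (mpf_pos _ _ Hw 1 2 ltac:(lra) ltac:(lra) ltac:(lra)) as wpos.
  pose proof (mpf_C _ _ Hw 1 2 ltac:(lra) ltac:(lra)) as HC.
  specialize (Fpos 1 2 ltac:(lra) ltac:(lra)).
  unfold C_term in HC.
  set (X := d_a F 1 2 * 1 ^ 2 + d_b F 1 2 * 2 ^ 2) in HC.
  assert (HX : 0 < X) by (unfold X; lra).
  replace (F 1 2 - d_a F 1 2 * 1 - d_b F 1 2 * 2) with ((1 - sigma) * F 1 2) in HC by lra.
  set (P := (1 - sigma) * F 1 2) in HC.
  assert (HP : 0 < P) by (apply Rmult_lt_0_compat; lra).
  replace (d_a w 1 2) with (chi * w 1 2 - 2 * d_b w 1 2) in HC by lra.
  (* The left side of [HC] now expands to [chi * w 1 2 * (X + P) + 2 * (P * d_b w 1 2)]; positivity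
     of both products contradicts [HC]. *)
  pose proof (Rmult_lt_0_compat _ _ (Rmult_lt_0_compat _ _ Hchi wpos)
                (Rplus_lt_0_compat _ _ HX HP)).
  pose proof (Rmult_lt_0_compat _ _ HP wb).
  lra.
Qed.
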